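(* Let $\mathbf A$ be a semi-Heyting algebra. Then $\mathbf A$ is anti-Boolean if and only if $\mathbf A$ satisfies (i) $(x^*\to x)^*\approx1$ and (ii) $x^*\vee y^*\vee(x\to y)\approx1$.
   Context: A semi-Heyting algebra is an algebra $\langle A;\wedge,\vee,\to,0,1\rangle$ such that $\langle A;\wedge,\vee,0,1\rangle$ is a bounded lattice and the identities $x\wedge(x\to y)\approx x\wedge y$, $x\wedge(y\to z)\approx x\wedge((x\wedge y)\to(x\wedge z))$, $x\to x\approx1$ hold. Write $x^*:=x\to0$. $\bar{\mathbf 2}$ is the semi-Heyting algebra on the chain $0<1$ with $0\to0=1$, $0\to1=0$, $1\to0=0$, $1\to1=1$; a semi-Heyting algebra is anti-Boolean if it belongs to the variety generated by $\bar{\mathbf 2}$. *)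

(* Defs.v *)
From mathcomp Require Import all_boot.

Set Implicit Arguments.
Unset Strict Implicit.
Unset Printing Implicit Defensive.

Record algebra := Algebra {
  carrier :> Type;
  meet : carrier -> carrier -> carrier;
  join : carrier -> carrier -> carrier;
  imp : carrier -> carrier -> carrier;
  zero : carrier;
  one : carrier }.

Arguments meet {a} _ _.
Arguments join {a} _ _.
Arguments imp {a} _ _.
Arguments zero {a}.
Arguments one {a}.

Declare Scope semi_heyting_scope.
Delimit Scope semi_heyting_scope with SH.
Local Open Scope semi_heyting_scope.

Notation "0" := zero : semi_heyting_scope.
Notation "1" := one : semi_heyting_scope.
Infix "∧" := meet (at level 40, left associativity) : semi_heyting_scope.
Infix "∨" := join (at level 50, left associativity) : semi_heyting_scope.
Infix "⇒" := imp (at level 55, right associativity) : semi_heyting_scope.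

Definition pcompl (A : algebra) (x : A) : A := x ⇒ 0.

Notation "x ^*" := (pcompl x) : semi_heyting_scope.

Record is_bounded_lattice (A : algebra) : Prop := IsBoundedLattice {
  meetC : commutative (@meet A);
  joinC : commutative (@join A);
  meetA : associative (@meet A);
  joinA : associative (@join A);
  meetKU : forall x y : A, x ∧ (x ∨ y) = x;
  joinKI : forall x y : A, x ∨ (x ∧ y) = x;
  meet0x : forall x : A, 0 ∧ x = 0;
  join1x : forall x : A, 1 ∨ x = 1 }.

Record is_semi_heyting (A : algebra) : Prop := IsSemiHeyting {
  semi_heyting_lattice : is_bounded_lattice A;
  meet_imp : forall x y : A, x ∧ (x ⇒ y) = x ∧ y;
  meet_impr : forall x y z : A, x ∧ (y ⇒ z) = x ∧ ((x ∧ y) ⇒ (x ∧ z));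
  impxx : forall x : A, (x ⇒ x) = 1 }.

Record semi_heyting := SemiHeyting {
  sh_algebra :> algebra;
  sh_axioms : is_semi_heyting sh_algebra }.

Record is_hom (A B : algebra) (f : A -> B) : Prop := IsHom {
  hom_meet : forall x y, f (x ∧ y) = f x ∧ f y;
  hom_join : forall x y, f (x ∨ y) = f x ∨ f y;
  hom_imp : forall x y, f (x ⇒ y) = (f x ⇒ f y);
  hom_zero : f 0 = 0;
  hom_one : f 1 = 1 }.

Definition product (I : Type) (A : I -> algebra) : algebra := {|
  carrier := forall i, A i;
  meet := fun x y i => x i ∧ y i;
  join := fun x y i => x i ∨ y i;
  imp := fun x y i => x i ⇒ y i;
  zero := fun i => 0;
  one := fun i => 1 |}.

(* Subalgebras are taken up to isomorphism, as embedded algebras; this is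
   harmless because a variety is closed under isomorphic images. The index
   type of a product may be empty. *)
Record is_variety (V : algebra -> Prop) : Prop := IsVariety {
  variety_image : forall (A B : algebra) (f : A -> B),
    is_hom f -> (forall y, exists x, f x = y) -> V A -> V B;
  variety_sub : forall (A B : algebra) (f : B -> A),
    is_hom f -> injective f -> V A -> V B;
  variety_product : forall (I : Type) (A : I -> algebra),
    (forall i, V (A i)) -> V (product A) }.

Definition variety_generated_by (B A : algebra) : Prop :=
  forall V : algebra -> Prop, is_variety V -> V B -> V A.

Definition bar2_algebra : algebra := {|
  carrier := bool;
  meet := andb;
  join := orb;
  imp := fun x y =>
    match x, y with
    | false, false => true
    | false, true => false
    | true, false => false
    | true, true => true
    end;
  zero := false;
  one := true |}.

Lemma bar2_is_semi_heyting : is_semi_heyting bar2_algebra.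
Proof. by split; [split|..]; repeat case. Qed.

Definition bar2 : semi_heyting := SemiHeyting bar2_is_semi_heyting.

Definition anti_boolean (A : semi_heyting) : Prop :=
  variety_generated_by bar2 A.

(* Main.v *)
(** Taking [x = 1] in (i) gives [0 ⇒ 1 = 0], the only instance of (i) needed.
    For [d := x ∨ x^*] one has [d^* = 0], so (ii) at [(1, d)] gives [1 ⇒ d = 1],
    hence [d = 1]: thus [x^*] is a complement of [x].
    On an ultrafilter [F] the equation [0 ⇒ 1 = 0] forces [x ⇒ y] to belong to
    [F] exactly when [x] and [y] agree on [F], so [F] is a homomorphism onto the
    two-element algebra. Distinct points are separated by ultrafilters, so the
    algebra embeds in a power of the two-element one. *)
From mathcomp Require Import boolp classical_sets.
Require Import Defs.
From mathcomp Require Import all_boot.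

Local Open Scope semi_heyting_scope.

Section SemiHeytingTheory.
Context {A : semi_heyting}.
Implicit Types x y z : A.

Let lat := semi_heyting_lattice (sh_axioms A).
Let mC : commutative (@meet A) := meetC lat.
Let mA : associative (@meet A) := meetA lat.

Lemma meetxx x : x ∧ x = x.
Proof. by rewrite -{2}(joinKI lat x x) (meetKU lat). Qed.

Lemma meetx0 x : x ∧ 0 = 0.
Proof. by rewrite mC (meet0x lat). Qed.

Lemma meetx1 x : x ∧ 1 = x.
Proof. by rewrite -(join1x lat x) (joinC lat) (meetKU lat). Qed.

Lemma meet1x x : 1 ∧ x = x.
Proof. by rewrite mC meetx1. Qed.

Lemma meet_le_trans y x z : x ∧ y = x -> y ∧ z = y -> x ∧ z = x.
Proof. by move=> xy yz; rewrite -{1}xy -mA yz. Qed.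

Lemma meet_le_anti x y : x ∧ y = x -> y ∧ x = y -> x = y.
Proof. by move=> xy yx; rewrite -xy mC. Qed.

Lemma meet_leIl x y : (x ∧ y) ∧ x = x ∧ y.
Proof. by rewrite mC mA meetxx. Qed.

Lemma meet_leIr x y : (x ∧ y) ∧ y = x ∧ y.
Proof. by rewrite -mA meetxx. Qed.

Lemma join_le x y z : x ∧ z = x -> y ∧ z = y -> (x ∨ y) ∧ z = x ∨ y.
Proof.
move=> xz yz; rewrite mC.
suff <- : (x ∨ y) ∨ z = z by rewrite mC (meetKU lat).
have le_join u : u ∧ z = u -> u ∨ z = z.
  by move=> <-; rewrite (joinC lat) (mC u) (joinKI lat).
by rewrite -(joinA lat) (le_join y yz) le_join.
Qed.

(* [y ⇒ (y ∧ z)] is the residual of [y ∧ _]; the operation [⇒] itself is not. *)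
Lemma residuation x y z : (x ∧ (y ⇒ (y ∧ z)) = x) <-> ((x ∧ y) ∧ z = x ∧ y).
Proof.
have H := sh_axioms A; split=> [xyz|xyz].
  rewrite -[in RHS]xyz -[RHS]mA (mC (y ⇒ _)) (meet_imp H) (mA y) meetxx.
  by rewrite mA.
rewrite (meet_impr H) [x ∧ (y ∧ z)]mA xyz.
have -> : x ∧ (x ∧ y ⇒ x ∧ y) = x ∧ 1 by rewrite (impxx H).
exact: meetx1.
Qed.

(** Distributivity in order form: by [residuation], [_ ∧ x] has an upper adjoint, so a bound on
    [u ∧ x] and [v ∧ x] passes to the join. *)
Lemma meet_join_le x y u v :
  (u ∧ x) ∧ y = u ∧ x -> (v ∧ x) ∧ y = v ∧ x ->
  ((u ∨ v) ∧ x) ∧ y = (u ∨ v) ∧ x.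
Proof. by move=> /residuation ux /residuation vx; apply/residuation/join_le. Qed.

Lemma meet_pcompl x : x ∧ x^* = 0.
Proof. by rewrite /pcompl (meet_imp (sh_axioms A)) meetx0. Qed.

(** Relativised to [y] by [meet_impr], [x ⇒ 0] becomes [0 ⇒ 0], which is [1]. *)
Lemma pcompl_le x y : x ∧ y = 0 -> y ∧ x^* = y.
Proof.
move=> xy; rewrite /pcompl (meet_impr (sh_axioms A)) mC (mC y x) xy meetx0.
by rewrite (impxx (sh_axioms A)) meet1x.
Qed.

Lemma pcompl1 : 1^* = 0 :> A.
Proof. by rewrite -(meet1x 1^*) meet_pcompl. Qed.

(** Maximality is encoded by [ultra_or], which also makes [F] nonempty. *)
Record ultrafilter (F : set A) : Prop := Ultrafilter {
  ultra_not0 : ~ F 0;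
  ultra_meet : forall x y, F x -> F y -> F (x ∧ y);
  ultra_up : forall x y, x ∧ y = x -> F x -> F y;
  ultra_or : forall x, F x \/ F x^* }.

Arguments ultra_not0 {F}.
Arguments ultra_meet {F}.
Arguments ultra_up {F} _ {x y}.
Arguments ultra_or {F}.

Lemma ultrafilter_exists (c : A) : c <> 0 -> exists2 F, ultrafilter F & F c.
Proof.
move=> c0.
(* Not requiring [c] in [F] makes the empty union of an empty chain admissible
   in Zorn's lemma; maximality recovers [F c]. *)
pose good (F : set A) := [/\ forall x y, F x -> F y -> F (x ∧ y),
  forall x y, x ∧ y = x -> F x -> F y & forall x, F x -> x ∧ c <> 0].
have [F [[FI Fup Fc] Fmax]] :
    exists F, good F /\ forall G, (F `<` G)%classic -> ~ good G.
  apply: Zorn_bigcup => C Cgood Ctot; split.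
  - move=> x y [X CX Xx] [Y CY Yy].
    have [XY|YX] := Ctot X Y CX CY.
      by exists Y => //; case: (Cgood Y CY) => YI _ _; apply: YI => //; apply: XY.
    by exists X => //; case: (Cgood X CX) => XI _ _; apply: XI => //; apply: YX.
  - move=> x y xy [X CX Xx]; exists X => //.
    by case: (Cgood X CX) => _ Xup _; apply: Xup xy Xx.
  - by move=> x [X CX Xx]; case: (Cgood X CX) => _ _; apply.
have maxF x : ~ F x -> exists2 a, F a \/ a = 1 & (a ∧ x) ∧ c = 0.
  move=> nFx; apply: contrapT => none.
  (* [G] is the filter generated by [F] and [x]; under [none] it is good and strictly larger than
     [F]. The option [a = 1] covers an [F] that might be empty. *)
  pose G := [set z | exists2 a, F a \/ a = 1 & (a ∧ x) ∧ z = a ∧ x]%classic.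
  apply: (Fmax G).
    split; last first.
      by move=> /(_ x) GF; apply/nFx/GF; exists 1; [right|exact: meet_leIr].
    by move=> a Fa; exists a; [left|exact: meet_leIl].
  split.
  - move=> z t [a Fa az] [b Fb bt]; exists (a ∧ b).
      case: Fa Fb => [Fa|->] [Fb|->]; rewrite ?meet1x ?meetx1; try by [left|right].
      by left; apply: FI.
    have az' : (a ∧ b) ∧ x = ((a ∧ b) ∧ x) ∧ z.
      by rewrite (mC a b) -!mA (mA a x z) az.
    by rewrite mA -az' -!mA (mA b x t) bt.
  - by move=> z t zt [a Fa az]; exists a => //; exact: meet_le_trans az zt.
  - by move=> z [a Fa az] zc; apply: none; exists a; rewrite // -az -mA zc meetx0.
have nFac a : F a \/ a = 1 -> a ∧ c <> 0 by case=> [/Fc//|->]; rewrite meet1x.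
have Fc' : F c.
  by apply: contrapT => /maxF[a Fa]; rewrite -mA meetxx; apply: nFac.
exists F => //; split=> //.
- by move=> /Fc; apply; rewrite (meet0x lat).
- move=> x; have [|/maxF[a Fa axc]] := EM (F x); [by left|right].
  (* [a ∧ c] is disjoint from [x], hence below [x^*]. *)
  apply: (Fup (a ∧ c)); last by case: Fa => [Fa|->]; rewrite ?meet1x //; apply: FI.
  by apply: pcompl_le; rewrite mA (mC x a).
Qed.

Section UltrafilterHom.
Context {F : set A} (uF : ultrafilter F).

Lemma ultra_pcompl x : F x^* <-> ~ F x.
Proof.
split=> [Fx' Fx|]; last by case: (ultra_or uF x).
by apply: (ultra_not0 uF); rewrite -(meet_pcompl x); apply: (ultra_meet uF).
Qed.

Lemma ultra_meetE x y : F (x ∧ y) <-> F x /\ F y.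
Proof.
split=> [Fxy|[]]; last exact: (ultra_meet uF).
by split; apply: (ultra_up uF) Fxy; [exact: meet_leIl|exact: meet_leIr].
Qed.

Lemma ultra_joinE x y : F (x ∨ y) <-> F x \/ F y.
Proof.
split=> [Fxy|]; last first.
  case; apply: (ultra_up uF); first exact: (meetKU lat).
  by rewrite (joinC lat) (meetKU lat).
apply: contrapT => /not_orP[/ultra_pcompl Fx /ultra_pcompl Fy].
have Fxy' : F (x^* ∧ y^*) by apply: (ultra_meet uF).
apply: ((ultra_pcompl (x^* ∧ y^*)).1 _ Fxy');
  apply: (ultra_up uF) Fxy; apply: join_le; apply: pcompl_le.
  by rewrite mC mA meet_pcompl (meet0x lat).
by rewrite -mA (mC _ y) meet_pcompl meetx0.
Qed.

Lemma ultra_impE x y : (0 ⇒ 1 : A) = 0 -> F (x ⇒ y) <-> (F x <-> F y).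
Proof.
move=> imp01; have H := sh_axioms A.
have [Fx|nFx] := EM (F x).
  have -> : F (x ⇒ y) <-> F (x ∧ y).
    by rewrite -(meet_imp H) ultra_meetE; tauto.
  by rewrite ultra_meetE; tauto.
have Fx' := (ultra_pcompl x).2 nFx.
suff : F (x ⇒ y) <-> ~ F y by tauto.
have [Fy|nFy] := EM (F y).
  split=> // Fxy; case: (ultra_not0 uF).
  (* Relativised to [x^* ∧ y], the implication [x ⇒ y] coincides with [0 ⇒ 1], which is [0]. *)
  have := ultra_meet uF _ _ (ultra_meet uF _ _ Fx' Fy) Fxy.
  rewrite (meet_impr H) meet_leIr -[(x^* ∧ y) ∧ x]mA (mC y x) (mA x^* x).
  rewrite (mC x^* x) meet_pcompl (meet0x lat).
  have := meet_impr H (x^* ∧ y) 0 1; rewrite meetx0 meetx1 imp01 meetx0.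
  by move=> <-.
split=> // _; have Fy' := (ultra_pcompl y).2 nFy.
(* Relativised to [x^* ∧ y^*], the implication becomes [0 ⇒ 0], which is [1]. *)
apply: (ultra_up uF) (ultra_meet uF _ _ Fx' Fy').
rewrite (meet_impr H) -[(x^* ∧ y^*) ∧ y]mA (mC y^* y) meet_pcompl meetx0.
rewrite (mC x^*) -[(y^* ∧ x^*) ∧ x]mA (mC x^* x) meet_pcompl meetx0.
by rewrite (impxx H) meetx1.
Qed.

Lemma ultra_hom : (0 ⇒ 1 : A) = 0 ->
  @is_hom A bar2 (fun x => `[< F x >]).
Proof.
move=> imp01; split=> /=.
- by move=> x y; rewrite -asbool_and; apply/asbool_equiv_eq/ultra_meetE.
- by move=> x y; rewrite -asbool_or; apply/asbool_equiv_eq/ultra_joinE.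
- move=> x y; rewrite (asbool_equiv_eq (ultra_impE x y imp01)).
  by case: (asboolP (F x)) (asboolP (F y)) => ? [] ?; apply/asboolP; tauto.
- exact/asboolF/(ultra_not0 uF).
- apply: asboolT; have [//|/(ultra_up uF)] := ultra_or uF 1.
  by apply; rewrite meetx1.
Qed.

End UltrafilterHom.

Lemma complemented_le x y :
  y ∨ y^* = 1 -> x ∧ y^* = 0 -> x ∧ y = x.
Proof.
move=> cy xy; rewrite -(meet1x x) -cy; apply: meet_join_le.
  by rewrite -!mA (mC x y) mA meetxx.
by rewrite (mC y^*) xy (meet0x lat).
Qed.

Lemma bar2_hom_separation x y : (0 ⇒ 1 : A) = 0 -> (forall z : A, z ∨ z^* = 1) ->
  (forall f : A -> bar2, is_hom f -> f x = f y) -> x = y.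
Proof.
move=> imp01 compl; move: x y.
suff le x y : (forall f : A -> bar2, is_hom f -> f x = f y) -> x ∧ y = x.
  by move=> x y fxy; apply: meet_le_anti; apply: le => // f /fxy.
(* If x ≤ y fails, [x ∧ y^*] is nonzero, and an ultrafilter containing it contains [x] but not
   [y]. *)
move=> fxy; apply: complemented_le => //; apply: contrapT.
move=> /ultrafilter_exists[F uF /(ultra_meetE uF)[Fx /(ultra_pcompl uF)]]; apply.
have := fxy _ (ultra_hom uF imp01); rewrite (asboolT Fx).
by move=> /esym/asboolP.
Qed.

Lemma anti_boolean_of_separation :
  (forall x y, (forall f : A -> bar2, is_hom f -> f x = f y) -> x = y) ->
  anti_boolean A.
Proof.
move=> sep V VV Vbar2; pose I := {f : A -> bar2 | is_hom f}.
(* Evaluation at all homomorphisms; separation is its injectivity. For a one-element [A] the index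
   type is empty. *)
pose ev (x : A) : product (fun _ : I => bar2) := fun i => sval i x.
apply: (variety_sub VV (f := ev)); last exact: (variety_product VV).
  by split=> [x y|x y|x y||]; apply: funext => -[f []]; rewrite /ev /=.
move=> x y exy; apply: sep => f fhom.
exact: (congr1 (fun g : product _ => g (exist _ f fhom)) exy).
Qed.

End SemiHeytingTheory.

Definition anti_boolean_identities (A : algebra) : Prop :=
  (forall x : A, (x^* ⇒ x)^* = 1) /\
  (forall x y : A, x^* ∨ y^* ∨ (x ⇒ y) = 1).

(** Instantiating [variety_generated_by] at this class reduces the forward implication to checking
    the identities in [bar2]. *)
Lemma anti_boolean_identities_variety : is_variety anti_boolean_identities.
Proof.
split=> [A B f fhom fsurj [Ai Aii]|A B f fhom finj [Ai Aii]|I A AV].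
- have fC x : f x^* = (f x)^* by rewrite /pcompl (hom_imp fhom) (hom_zero fhom).
  split=> [y|y z]; have [x <-] := fsurj y.
    by rewrite -fC -(hom_imp fhom) -fC Ai (hom_one fhom).
  have [t <-] := fsurj z.
  by rewrite -!fC -(hom_imp fhom) -!(hom_join fhom) Aii (hom_one fhom).
- have fC x : f x^* = (f x)^* by rewrite /pcompl (hom_imp fhom) (hom_zero fhom).
  split=> [x|x y]; apply: finj; rewrite (hom_one fhom).
    by rewrite fC (hom_imp fhom) fC Ai.
  by rewrite !(hom_join fhom) !fC (hom_imp fhom) Aii.
- split=> [x|x y]; apply: functional_extensionality_dep => i.
    exact: (AV i).1.
  exact: (AV i).2.
Qed.

(** An element with pseudocomplement [1] is [0], since the two meet in [0]. *)
Lemma identities_imp01 (A : semi_heyting) :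
  anti_boolean_identities A -> (0 ⇒ 1 : A) = 0.
Proof.
move=> [Ai _]; have := Ai 1; rewrite pcompl1 => imp01.
by have := meet_pcompl (0 ⇒ 1 : A); rewrite imp01 meetx1.
Qed.

Lemma identities_complemented (A : semi_heyting) (x : A) :
  anti_boolean_identities A -> x ∨ x^* = 1.
Proof.
move=> [_ Aii]; set d := x ∨ x^*.
have H := sh_axioms A; have lat := semi_heyting_lattice H.
(* [d^*] is disjoint from [x], so below [x^*], yet it is disjoint from [x^*] as well. *)
have d0 : d^* = 0.
  have xd : x ∧ d^* = 0.
    by rewrite -(meetKU lat x x^*) -(meetA lat) meet_pcompl meetx0.
  have x'd : x^* ∧ d^* = 0.
    by rewrite -(meetKU lat x^* x) -(meetA lat) (joinC lat) meet_pcompl meetx0.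
  by have := pcompl_le x d^* xd; rewrite (meetC lat) x'd.
have join0x (z : A) : 0 ∨ z = z.
  by rewrite (joinC lat) -(meetx0 z) (joinKI lat).
have := Aii 1 d; rewrite pcompl1 d0 !join0x => imp1d.
by have := meet_imp H 1 d; rewrite imp1d meetxx meet1x.
Qed.

Theorem theorem7p4 (A : semi_heyting) :
  anti_boolean A <->
  (forall x : A, (x^* ⇒ x)^* = 1) /\
  (forall x y : A, x^* ∨ y^* ∨ (x ⇒ y) = 1).
Proof.
split=> [abA|idA].
  apply: (abA _ anti_boolean_identities_variety).
  by split; [case|case=> -[]].
apply: anti_boolean_of_separation => x y; apply: bar2_hom_separation.
  exact: identities_imp01.
by move=> z; apply: identities_complemented.
Qed.
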